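(* The (decision version of the) bottleneck pyramidal TSP on $n$ points in the Euclidean plane has a lower bound of $\Omega(n\log n)$ in the algebraic computation tree model: deciding, for a linearly ordered set $P$ of $n$ points in the plane and a value $B>0$, whether $P$ admits a pyramidal tour whose longest edge has Euclidean length at most $B$, requires $\Omega(n\log n)$ time in this model.
   Context: For a linear order $p_1,\ldots,p_n$ of the points, a pyramidal tour is a Hamiltonian cycle on the points of the form $(p_1,p_{i_1},\ldots,p_{i_r},p_n,p_{j_1},\ldots,p_{j_{n-r-2}})$ with $i_1<i_2<\cdots<i_r$ and $j_1>j_2>\cdots>j_{n-r-2}$. *)

(* Defs.v *)
From Stdlib Require Import Reals.
From mathcomp Require Import all_boot.

Set Implicit Arguments.
Unset Strict Implicit.
Unset Printing Implicit Defensive.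

Definition edist (p q : R * R) : R :=
  sqrt (Rplus (Rsqr (Rminus (fst p) (fst q))) (Rsqr (Rminus (snd p) (snd q)))).

(* ---------- Pyramidal tours ----------
   Points are indexed 0..n-1 in their linear order (p_1 = index 0,
   p_n = index n-1).  A tour is given as the cyclic sequence of visited
   indices.  It is pyramidal iff it is a Hamiltonian cycle (a permutation
   of 0..n-1) of the form 0 :: a ++ (n-1) :: b with a strictly increasing
   and b strictly decreasing. *)
Definition pyramidal (n : nat) (t : seq nat) : Prop :=
  perm_eq t (iota 0 n) /\
  exists a b : seq nat,
    t = 0%N :: a ++ n.-1 :: b /\ sorted ltn a /\ sorted (fun x y => y < x) b.

Definition bottleneck_le (pts : nat -> R * R) (t : seq nat) (B : R) : Prop :=
  forall k : nat, (k < size t)%N ->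
    Rle (edist (pts (nth 0%N t k)) (pts (nth 0%N t ((k.+1) %% size t)))) B.

Definition BPTSP_yes (n : nat) (pts : nat -> R * R) (B : R) : Prop :=
  exists t : seq nat, pyramidal n t /\ bottleneck_le pts t B.

(* ---------- Algebraic computation trees (Ben-Or) ----------
   Operands: an input variable, a previously computed value, or an
   arbitrary real constant.  Internal nodes: an arithmetic operation
   (+, -, *, /) or a square root, each storing a new value, or a
   three-way sign test.  Leaves: accept / reject.
   Conventions for partial operations: x / 0 and sqrt of a negative are
   given the values of Stdlib's total functions; these can be simulated
   by a constant number of extra nodes, so they do not affect the
   asymptotic model. *)
Inductive operand : Type :=
| In  : nat -> operand
| Val : nat -> operand
| Cst : R -> operand.

Inductive binop : Type := OAdd | OSub | OMul | ODiv.

Inductive act : Type :=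
| Leaf   : bool -> act
| Op     : binop -> operand -> operand -> act -> act
| Sqrt   : operand -> act -> act
| Branch : operand -> act -> act -> act -> act.  (* < 0 | = 0 | > 0 *)

Definition operand_val (inp env : seq R) (o : operand) : R :=
  match o with
  | In i => nth R0 inp i
  | Val j => nth R0 env j
  | Cst c => c
  end.

Definition binop_val (o : binop) (x y : R) : R :=
  match o with
  | OAdd => Rplus x y
  | OSub => Rminus x y
  | OMul => Rmult x y
  | ODiv => Rdiv x y
  end.

Fixpoint act_eval (T : act) (inp env : seq R) : bool :=
  match T with
  | Leaf b => b
  | Op o a b k =>
      act_eval k inp (rcons env (binop_val o (operand_val inp env a)
                                              (operand_val inp env b)))
  | Sqrt a k => act_eval k inp (rcons env (sqrt (operand_val inp env a)))
  | Branch a tl te tg =>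
      match total_order_T (operand_val inp env a) R0 with
      | inleft (left _) => act_eval tl inp env
      | inleft (right _) => act_eval te inp env
      | inright _ => act_eval tg inp env
      end
  end.

(* running time = depth = number of nodes on the longest root-leaf path *)
Fixpoint act_depth (T : act) : nat :=
  match T with
  | Leaf _ => 0
  | Op _ _ _ k => (act_depth k).+1
  | Sqrt _ k => (act_depth k).+1
  | Branch _ tl te tg => (maxn (act_depth tl) (maxn (act_depth te) (act_depth tg))).+1
  end.

Definition encode (n : nat) (pts : nat -> R * R) (B : R) : seq R :=
  flatten [seq [:: fst (pts i); snd (pts i)] | i <- iota 0 n] ++ [:: B].

Definition decides_BPTSP (n : nat) (T : act) : Prop :=
  forall (pts : nat -> R * R) (B : R),
    Rlt R0 B ->
    (forall i j : nat, (i < n)%N -> (j < n)%N -> i <> j -> pts i <> pts j) ->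
    (act_eval T (encode n pts B) [::] = true <-> BPTSP_yes n pts B).

(* Main.v *)
From Stdlib Require Import Reals.
From Stdlib Require Psatz.
From mathcomp Require Import all_boot all_order all_algebra all_fingroup.
From mathcomp Require Import boolp classical_sets functions reals topology normedtype derive.
From mathcomp Require Import Rstruct lra zify.
Require Import Defs.

(**
Place the points on two vertical lines at distance [B], the first indices on the left line
and the remaining ones on the right line, so that an edge between the lines has length at
most [B] only if it is horizontal.  A pyramidal tour crosses twice between the lines.  One
horizontal bridge is provided, hence a tour exists exactly if one of [k] free points on the
right line is level with a fixed point on the left line, at an integer height.  Letting the
free heights range over pairwise disjoint unit cubes with integer vertices, one for each
permutation of [k] elements, the no-instances are the interiors of these [k!] cubes.

The inputs that reach a given leaf of a tree of depth [h] are projections of the zero set of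
a nonnegative polynomial [F] of degree 6 in at most [k + 2h] variables.  If a rejecting leaf
is reached from several cubes, then [F] vanishes somewhere inside each of them and nowhere on
their boundaries, so [M F + \sum_i w_i ^ 8] has for large [M] a critical point in each cube.
On the set of critical points [w_i ^ 7] equals a polynomial of degree less than 7, so that
all functions on that set are combinations of the [7 ^ (k + 2h)] monomials with exponents
less than 7; this bounds the number of cubes.  Hence [k! <= 3 ^ h * 7 ^ (k + 2h)].
*)

Set Implicit Arguments.
Unset Strict Implicit.
Unset Printing Implicit Defensive.
Import Order.TTheory GRing.Theory Num.Theory.
Import numFieldNormedType.Exports.
Local Open Scope ring_scope.

(** * Polynomial functions *)

Definition upd (R : Type) (w : nat -> R) (i : nat) (t : R) : nat -> R :=
  fun j => if j == i then t else w j.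

Lemma upd_upd (R : Type) (w : nat -> R) i s t : upd (upd w i s) i t = upd w i t.
Proof. by apply: funext => j; rewrite /upd; case: eqP. Qed.

Lemma upd_id (R : Type) (w : nat -> R) i : upd w i (w i) = w.
Proof. by apply: funext => j; rewrite /upd; case: eqP => // ->. Qed.

(** The index [d] is only an upper bound for the degree. Points are functions on all of [nat], so a
    polynomial stays the same function when variables are added. *)
Inductive polyfun (R : realType) (m : nat) : nat -> ((nat -> R) -> R) -> Prop :=
| polyfun_cst d c : polyfun m d (fun=> c)
| polyfun_var d i : (i < m)%N -> polyfun m d.+1 (fun w => w i)
| polyfun_add d f g : polyfun m d f -> polyfun m d g ->
    polyfun m d (fun w => f w + g w)
| polyfun_mul d e f g : polyfun m d f -> polyfun m e g ->
    polyfun m (d + e) (fun w => f w * g w).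

Lemma polyfun_leq (R : realType) m m' d d' (f : (nat -> R) -> R) :
  (m <= m')%N -> (d <= d')%N -> polyfun m d f -> polyfun m' d' f.
Proof.
move=> mm' dd' pf; elim: pf d' dd' => {d f}.
- by move=> d c d' _; apply: polyfun_cst.
- by move=> d i im [//|d'] _; apply: polyfun_var; apply: leq_trans mm'.
- by move=> d f g _ IHf _ IHg d' dd'; apply: polyfun_add; [exact: IHf|exact: IHg].
- move=> d e f g _ IHf _ IHg d' dd'.
  by rewrite (_ : d' = d + (d' - d))%N; [apply: polyfun_mul; [exact: IHf|apply: IHg]|]; lia.
Qed.

Lemma polyfun_opp (R : realType) m d (f : (nat -> R) -> R) :
  polyfun m d f -> polyfun m d (fun w => - f w).
Proof.
move=> pf; rewrite (_ : (fun w => - f w) = (fun w => (fun=> -1) w * f w)).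
  exact: (polyfun_mul (polyfun_cst m 0 (-1)) pf).
by apply: funext => w; rewrite mulN1r.
Qed.

Lemma polyfun_sub (R : realType) m d (f g : (nat -> R) -> R) :
  polyfun m d f -> polyfun m d g -> polyfun m d (fun w => f w - g w).
Proof. by move=> pf pg; apply: polyfun_add => //; apply: polyfun_opp. Qed.

Lemma polyfun_exp (R : realType) m i k :
  (i < m)%N -> polyfun m k (fun w : nat -> R => w i ^+ k).
Proof.
move=> im; elim: k => [|k IHk]; first exact: polyfun_cst.
rewrite (_ : (fun w => _) = (fun w => w i * w i ^+ k)); last first.
  by apply: funext => w; rewrite exprS.
by rewrite -add1n; apply: polyfun_mul => //; apply: polyfun_var.
Qed.

Lemma polyfun_mono_prod (R : realType) m (a : nat -> nat) :
  polyfun m (\sum_(i < m) a i) (fun w : nat -> R => \prod_(i < m) w i ^+ a i).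
Proof.
have : forall s : seq 'I_m, polyfun m (\sum_(i <- s) a i)
    (fun w : nat -> R => \prod_(i <- s) w i ^+ a i).
  elim=> [|i s IHs].
    rewrite (_ : (fun w => _) = (fun=> 1)); first exact: polyfun_cst.
    by apply: funext => w; rewrite big_nil.
  rewrite big_cons (_ : (fun w => _) =
    (fun w : nat -> R => w i ^+ a i * \prod_(i <- s) w i ^+ a i)).
    by apply: polyfun_mul => //; apply: polyfun_exp.
  by apply: funext => w; rewrite big_cons.
by apply.
Qed.

Lemma polyfun_ext (R : realType) m d (f : (nat -> R) -> R) w w' :
  polyfun m d f -> (forall i, (i < m)%N -> w i = w' i) -> f w = f w'.
Proof.
move=> pf ww'; elim: pf => {d f}.
- by [].
- by move=> _ i im; apply: ww'.
- by move=> d f g _ -> _ ->.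
- by move=> d e f g _ -> _ ->.
Qed.

(* The clause on [d = 0] lets the truncated degree [d.-1] survive the product rule. *)
Lemma polyfun_is_derive (R : realType) m d (f : (nat -> R) -> R) (i : nat) :
  polyfun m d f -> exists g : (nat -> R) -> R, [/\ polyfun m d.-1 g, d = 0%N -> g = (fun=> 0) &
    forall w : nat -> R, is_derive (w i) (1 : R) (fun t : R => f (upd w i t)) (g w)].
Proof.
elim=> {d f}.
- move=> d c; exists (fun=> 0); split => //; first exact: polyfun_cst.
  by move=> w; apply: is_derive_cst.
- move=> d j jm; exists (fun=> (j == i)%:R); split => //; first exact: polyfun_cst.
  move=> w; rewrite /upd; case: (j == i); first exact: is_derive_id.
  exact: is_derive_cst.
- move=> d f g _ [f' [pf f0 df]] _ [g' [pg g0 dg]].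
  exists (fun w => f' w + g' w); split; first exact: polyfun_add.
    by move=> d0; apply: funext => w; rewrite f0 // g0 // addr0.
  by move=> w; apply: is_deriveD.
- move=> d e f g pf [f' [pf' f0 df]] pg [g' [pg' g0 dg]].
  exists (fun w => f w * g' w + g w * f' w); split.
  + apply: polyfun_add.
    * case: e pg pg' g0 {dg} => [|e] pg pg' g0.
        rewrite g0 // (_ : (fun w => _) = (fun=> 0)); first exact: polyfun_cst.
        by apply: funext => w; rewrite mulr0.
      by rewrite addnS /=; apply: polyfun_mul.
    * case: d pf pf' f0 {df} => [|d] pf pf' f0.
        rewrite f0 // (_ : (fun w => _) = (fun=> 0)); first exact: polyfun_cst.
        by apply: funext => w; rewrite mulr0.
      by rewrite addSn /= addnC; apply: polyfun_mul.
  + move=> /eqP; rewrite addn_eq0 => /andP[/eqP d0 /eqP e0].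
    by apply: funext => w; rewrite f0 // g0 // !mulr0 addr0.
  + move=> w; have := is_deriveM (df w) (dg w).
    by rewrite upd_id.
Qed.

(** Links row vectors, where compactness of boxes is available, to the points on which polynomials
    act. *)
Definition ord_fun (R : realType) m (v : 'rV[R]_m) : nat -> R :=
  fun i => if insub i is Some j then v ord0 j else 0.

Lemma ord_funE (R : realType) m (v : 'rV[R]_m) (j : 'I_m) : ord_fun v j = v ord0 j.
Proof. by rewrite /ord_fun valK. Qed.

Lemma polyfun_continuous (R : realType) m d (f : (nat -> R) -> R) :
  polyfun m d f -> continuous (fun v : 'rV[R]_m => f (ord_fun v)).
Proof.
elim=> {d f}.
- by move=> d c; apply: cst_continuous.
- move=> d i im; rewrite (_ : (fun v => _) = (fun v : 'rV[R]_m => v ord0 (Ordinal im))).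
    exact: coord_continuous.
  by apply: funext => v; rewrite -ord_funE.
- by move=> d f g _ cf _ cg v; apply: (continuousD (cf v) (cg v)).
- by move=> d e f g _ cf _ cg v; apply: (continuousM (cf v) (cg v)).
Qed.

Lemma polyfun_min_box (R : realType) m d (f : (nat -> R) -> R) (lo hi : nat -> R) :
  polyfun m d f -> (forall i, (i < m)%N -> lo i <= hi i) ->
  exists2 z, forall i, (i < m)%N -> lo i <= z i <= hi i &
    forall w, (forall i, (i < m)%N -> lo i <= w i <= hi i) -> f z <= f w.
Proof.
move=> pf lohi.
pose A := [set v : 'rV[R]_m | forall i : 'I_m, `[lo i, hi i]%classic (v ord0 i)]%classic.
have cA : compact A.
  by apply: (@rV_compact R m (fun i => `[lo i, hi i]%classic)) => i; exact: segment_compact.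
have A0 : (A !=set0)%classic.
  by exists (\row_(i < m) lo i) => i /=; rewrite mxE in_itv /= lexx lohi.
have cf : {within A, continuous (fun v : 'rV[R]_m => f (ord_fun v))}%classic.
  by apply: continuous_subspaceT => v; apply: (polyfun_continuous pf).
have [c /set_mem Ac minc] := EVT_min_rV A0 cA cf.
exists (ord_fun c) => [i im|w wb].
  by have := Ac (Ordinal im); rewrite /= in_itv /= -ord_funE.
have ww : forall i, (i < m)%N -> w i = ord_fun (\row_(i < m) w i) i.
  by move=> i im; rewrite (ord_funE _ (Ordinal im)) mxE.
rewrite (polyfun_ext pf ww); apply: minc; apply: mem_set => i /=.
by rewrite mxE in_itv /= wb.
Qed.

(** This replaces the expansion into monomials. For a product the two factors are expanded in turn,
    the other one being absorbed into the predicate [V]. *)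
Lemma polyfun_monomial_ind (R : realType) m d (f : (nat -> R) -> R)
    (V : ((nat -> R) -> R) -> Prop) :
  V (fun=> 0) ->
  (forall f g, V f -> V g -> V (fun w => f w + g w)) ->
  (forall c f, V f -> V (fun w => c * f w)) ->
  (forall a : nat -> nat, (\sum_(i < m) a i <= d)%N ->
     V (fun w => \prod_(i < m) w i ^+ a i)) ->
  polyfun m d f -> V f.
Proof.
move=> V0 VD VZ VM pf; elim: pf V V0 VD VZ VM => {d f}.
- move=> d c V V0 VD VZ VM.
  have -> : (fun=> c) = (fun w : nat -> R => c * \prod_(i < m) w i ^+ 0).
    by apply: funext => w; rewrite big1 ?mulr1.
  by apply/VZ/(VM (fun=> 0%N)); rewrite big1.
- move=> d i im V V0 VD VZ VM.
  have -> : (fun w : nat -> R => w i) =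
      (fun w => \prod_(j < m) w j ^+ (fun k => (k == i) : nat) j).
    apply: funext => w; rewrite (bigD1 (Ordinal im)) //= eqxx big1 ?mulr1 //.
    by move=> j; rewrite -val_eqE /= => /negbTE->.
  apply: (VM (fun k => (k == i) : nat)).
  rewrite (bigD1 (Ordinal im)) //= eqxx big1 ?addn0 //.
  by move=> j; rewrite -val_eqE /= => /negbTE->.
- move=> d f g _ IHf _ IHg V V0 VD VZ VM.
  exact: (VD f g (IHf V V0 VD VZ VM) (IHg V V0 VD VZ VM)).
- move=> d e f g _ IHf _ IHg V V0 VD VZ VM.
  apply: (IHf (fun f => V (fun w => f w * g w))) => [|f1 f2|c f1|a ad].
  + by rewrite (_ : (fun w => _) = (fun=> 0)) //; apply: funext => w; rewrite mul0r.
  + move=> V1 V2; rewrite (_ : (fun w => _) = (fun w => f1 w * g w + f2 w * g w)).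
      exact: (VD (fun w => f1 w * g w) (fun w => f2 w * g w)).
    by apply: funext => w; rewrite mulrDl.
  + move=> V1; rewrite (_ : (fun w => _) = (fun w => c * (f1 w * g w))).
      exact: (VZ _ _ V1).
    by apply: funext => w; rewrite mulrA.
  apply: (IHg (fun g => V (fun w => (\prod_(i < m) w i ^+ a i) * g w)))
      => [|f1 f2|c f1|b be].
  + by rewrite (_ : (fun w => _) = (fun=> 0)) //; apply: funext => w; rewrite mulr0.
  + move=> V1 V2; rewrite (_ : (fun w => _) = (fun w : nat -> R =>
      (\prod_(i < m) w i ^+ a i) * f1 w + (\prod_(i < m) w i ^+ a i) * f2 w)).
      exact: (VD _ _ V1 V2).
    by apply: funext => w; rewrite mulrDr.
  + move=> V1; rewrite (_ : (fun w => _) =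
      (fun w : nat -> R => c * ((\prod_(i < m) w i ^+ a i) * f1 w))); first exact: (VZ _ _ V1).
    by apply: funext => w; rewrite mulrCA.
  rewrite (_ : (fun w => _) = (fun w : nat -> R => \prod_(i < m) w i ^+ (fun i => a i + b i)%N i)).
    by apply: (VM (fun i => a i + b i)%N); rewrite big_split leq_add.
  by apply: funext => w; rewrite -big_split; apply: eq_bigr => i _; rewrite exprD.
Qed.

(** Strong induction on the degree: in a monomial with an exponent at least [e], a factor [w i ^+ e]
    is replaced by [r i w], which lowers the degree because [r i] has degree less than [e]. *)
Lemma polyfun_reduce (R : realType) m e (P : (nat -> R) -> Prop)
    (r : nat -> (nat -> R) -> R) :
  (forall i, (i < m)%N -> polyfun m e.-1 (r i)) -> (0 < e)%N ->
  (forall i w, (i < m)%N -> P w -> w i ^+ e = r i w) ->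
  forall d f, polyfun m d f -> exists c : {ffun 'I_m -> 'I_e} -> R,
    forall w, P w -> f w = \sum_a c a * \prod_(i < m) w i ^+ a i.
Proof.
move=> pr e0 Pr d; have [n dn] := ubnP d; elim: n d dn => // n IHn d dn f pf.
pose V f := exists c : {ffun 'I_m -> 'I_e} -> R,
  forall w, P w -> f w = \sum_a c a * \prod_(i < m) w i ^+ a i.
apply: (polyfun_monomial_ind (V := V) _ _ _ _ pf) => {f pf}
    [|f g [c Hc] [c' Hc']|x f [c Hc]|a ad].
- by exists (fun=> 0) => w _; rewrite big1 // => i _; rewrite mul0r.
- exists (fun a => c a + c' a) => w Pw; rewrite Hc // Hc' // -big_split /=.
  by apply: eq_bigr => i _; rewrite mulrDl.
- exists (fun a => x * c a) => w Pw; rewrite Hc // big_distrr /=.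
  by apply: eq_bigr => i _; rewrite mulrA.
have [/forallP ae|/forallPn[i]] := boolP [forall i : 'I_m, a i < e]%N.
  pose b : {ffun 'I_m -> 'I_e} := [ffun i => Ordinal (ae i)].
  exists (fun a => (a == b)%:R) => w Pw.
  rewrite (bigD1 b) //= eqxx mul1r [X in _ = _ + X]big1 ?addr0.
    by apply: eq_bigr => i _; rewrite ffunE.
  by move=> j /negbTE->; rewrite mul0r.
rewrite -leqNgt => ei.
pose b j := (a j - (j == i) * e)%N.
have ab (j : 'I_m) : (a j = (j == i) * e + b j)%N.
  by rewrite /b subnKC //; case: eqP => [->|_]; rewrite ?mul1n ?mul0n.
have sab : (\sum_(i < m) a i = e + \sum_(i < m) b i)%N.
  rewrite (eq_bigr _ (fun j _ => ab j)) big_split /= (bigD1 i) //= eqxx mul1n.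
  rewrite big1 ?addn0 // => j; rewrite -val_eqE /= => /negbTE ji.
  by rewrite ji.
have [c Hc] : exists c : {ffun 'I_m -> 'I_e} -> R, forall w, P w ->
    r i w * \prod_(i < m) w i ^+ b i = \sum_a c a * \prod_(i < m) w i ^+ a i.
  apply: (IHn (e.-1 + \sum_(i < m) b i)%N); first by lia.
  by apply: polyfun_mul; [exact: pr|exact: polyfun_mono_prod].
exists c => w Pw; rewrite -Hc // -(Pr i) //.
rewrite (eq_bigr (fun j : 'I_m => w j ^+ ((j == i) * e) * w j ^+ b j)).
  rewrite big_split /= (bigD1 i) //= eqxx mul1n big1 ?mulr1 // => j.
  by rewrite -val_eqE /= => /negbTE ji; rewrite ji.
by move=> j _; rewrite -exprD -ab.
Qed.

(** Lagrange interpolation: every other point contributes an affine factor in a coordinate that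
    separates it from [p a]. *)
Lemma polyfun_interpolation (R : realType) m (I : finType) (p : I -> nat -> R) :
  (forall a b, a != b -> exists2 l, (l < m)%N & p a l != p b l) ->
  forall a, exists2 f, exists d, polyfun m d f & forall b, f (p b) = (b == a)%:R.
Proof.
move=> sep a.
have : forall s : seq I, exists2 f, exists d, polyfun m d f &
    f (p a) = 1 /\ forall b, b \in s -> b != a -> f (p b) = 0.
  elim=> [|c s [f [d pf] [fa fs]]].
    by exists (fun=> 1); [exists 0%N; exact: polyfun_cst|].
  have [->|ca] := eqVneq c a.
    exists f; first by exists d.
    split=> // b; rewrite inE => /orP[/eqP->|]; first by rewrite eqxx.
    exact: fs.
  have [l lm pl] := sep _ _ ca.
  exists (fun w => (p a l - p c l)^-1 * (w l - p c l) * f w).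
    exists (0 + 1 + d)%N; apply: polyfun_mul => //.
    apply: (@polyfun_mul R m 0 1 (fun=> (p a l - p c l)^-1) (fun w => w l - p c l)).
      exact: polyfun_cst.
    by apply: polyfun_sub; [exact: polyfun_var|exact: polyfun_cst].
  have pl0 : p a l - p c l != 0 by rewrite subr_eq0 eq_sym.
  split; first by rewrite fa mulr1 mulVf.
  move=> b; rewrite inE => /orP[/eqP->|bs] ba; first by rewrite subrr mulr0 mul0r.
  by rewrite fs ?mulr0.
move=> /(_ (enum I))[f pf [fa fs]]; exists f => // b.
have [->//|ba] := eqVneq b a.
by apply: fs; rewrite ?mem_enum.
Qed.

(** The indicator functions of the points are polynomials, hence combinations of the [e ^ m] reduced
    monomials. So the identity matrix of size [#|I|] factors through dimension [e ^ m], and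
    comparing ranks gives the bound. *)
Lemma card_reduced_points (R : realType) m e (I : finType) (p : I -> nat -> R)
    (r : nat -> (nat -> R) -> R) :
  (forall a b, a != b -> exists2 l, (l < m)%N & p a l != p b l) ->
  (forall i, (i < m)%N -> polyfun m e.-1 (r i)) -> (0 < e)%N ->
  (forall i a, (i < m)%N -> p a i ^+ e = r i (p a)) ->
  (#|I| <= e ^ m)%N.
Proof.
move=> sep pr e0 Pr.
have Hc a : exists c : {ffun 'I_m -> 'I_e} -> R, forall b,
    (b == a)%:R = \sum_u c u * \prod_(i < m) p b i ^+ u i.
  have [f [d pf] fE] := polyfun_interpolation sep a.
  have [|c Hc] := @polyfun_reduce R m e (fun w => exists b, w = p b) r pr e0 _ d f pf.
    by move=> i w im [b ->]; apply: Pr.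
  by exists c => b; rewrite -fE Hc //; exists b.
have [c {}Hc] := choice Hc.
pose C : 'M[R]_(#|I|, #|{ffun 'I_m -> 'I_e}|) :=
  \matrix_(i, j) c (enum_val i) (enum_val j).
pose E : 'M[R]_(#|{ffun 'I_m -> 'I_e}|, #|I|) :=
  \matrix_(i, j) \prod_(l < m) p (enum_val j) l ^+ (enum_val i : {ffun 'I_m -> 'I_e}) l.
have CE : C *m E = 1%:M.
  apply/matrixP => i j; rewrite !mxE.
  rewrite (_ : (i == j) = (enum_val j == enum_val i)); last first.
    by rewrite (inj_eq enum_val_inj) eq_sym.
  rewrite Hc (reindex (@enum_val _ (predT : pred {ffun 'I_m -> 'I_e}))) /=.
    by apply: eq_bigr => l _; rewrite !mxE.
  by apply: onW_bij; apply: enum_val_bij.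
have := mulmx1_min_rank (A := C) (M := 1%:M) (N := E).
rewrite mul1mx => /(_ CE) /leq_trans/(_ (rank_leq_col C)).
by rewrite card_ffun !card_ord.
Qed.

(** * Counting separated zeros *)

Lemma fin_eventually_forall (R : realType) (I : finType) (P : I -> R -> Prop) :
  (forall i, exists M0, forall M, M0 <= M -> P i M) ->
  exists M0, forall M, M0 <= M -> forall i, P i M.
Proof.
move=> /choice[f Hf]; exists (\sum_i `|f i|) => M fM i; apply: Hf.
apply: le_trans fM; apply: le_trans (ler_norm _) _.
by rewrite (bigD1 i) //= lerDl sumr_ge0.
Qed.

Lemma polyfun_critical (R : realType) m d (f : (nat -> R) -> R) z lo hi i :
  polyfun m d f -> (i < m)%N ->
  (forall j, (j < m)%N -> lo j < z j < hi j) ->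
  (forall w, (forall j, (j < m)%N -> lo j <= w j <= hi j) -> f z <= f w) ->
  is_derive (z i) (1 : R) (fun t : R => f (upd z i t)) 0.
Proof.
move=> pf im zb minz; have [g [_ _ dg]] := polyfun_is_derive i pf.
have /andP[loz zhi] := zb i im.
apply: (@derive1_at_min _ _ (lo i) (hi i)).
- exact/ltW/(lt_trans loz).
- move=> t _; have := dg (upd z i t).
  rewrite {1}/upd eqxx; under eq_fun do rewrite upd_upd.
  by case.
- by rewrite in_itv /= loz.
- move=> t; rewrite in_itv /= => /andP[lot thi]; rewrite upd_id; apply: minz => j jm.
  rewrite /upd; case: eqP => [->|_]; first by rewrite !ltW.
  by have /andP[? ?] := zb j jm; rewrite !ltW.
Qed.

(* A substitute for the Milnor-Thom bound.  For large [M] the function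
   [M * F w + \sum_i w i ^+ (2d+2)] has a minimum in the interior of each box, and the
   critical equations express [w i ^+ (2d+1)] by polynomials of lower degree, so that
   there are at most [(2d+1) ^ m] critical points. *)
Lemma card_separated_zeros (R : realType) m k d (F : (nat -> R) -> R)
    (I : finType) (lo hi : I -> nat -> R) :
  polyfun m d.*2 F -> (forall w, 0 <= F w) -> (k <= m)%N ->
  (forall a b, a != b -> exists2 j, (j < k)%N & hi a j < lo b j \/ hi b j < lo a j) ->
  (forall a, exists w, F w = 0 /\ forall j, (j < k)%N -> lo a j <= w j <= hi a j) ->
  (forall a w, F w = 0 -> (forall j, (j < k)%N -> lo a j <= w j <= hi a j) ->
     forall j, (j < k)%N -> w j != lo a j /\ w j != hi a j) ->
  (#|I| <= d.*2.+1 ^ m)%N.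
Proof.
move=> pF F0 km sep /choice[w0 w0P] face.
have w0F a : F (w0 a) = 0 by have [] := w0P a.
have w0b a : forall j, (j < k)%N -> lo a j <= w0 a j <= hi a j by have [] := w0P a.
pose S (w : nat -> R) := \sum_(i < m) w i ^+ d.+1.*2.
have X0 (x : R) : 0 <= x ^+ d.+1.*2 by rewrite exprn_even_ge0 // odd_double.
have S0 w : 0 <= S w by apply: sumr_ge0.
have leS w i : (i < m)%N -> w i ^+ d.+1.*2 <= S w.
  by move=> im; rewrite /S (bigD1 (Ordinal im)) //= lerDl sumr_ge0.
(* The coordinates from [k] on are confined to [[- rho, rho]], with [rho] so large that [S] exceeds
   every [S (w0 a)] on these outer faces. The summand 1 ensures that [rho] is at most its power. *)
pose rho := 1 + \sum_a S (w0 a).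
have rho1 : 1 <= rho by rewrite lerDl sumr_ge0.
have Srho a : S (w0 a) < rho ^+ d.+1.*2.
  apply: (@lt_le_trans _ _ rho).
    rewrite /rho (bigD1 a) //=.
    have : 0 <= \sum_(b | b != a) S (w0 b) by apply: sumr_ge0.
    by lra.
  by rewrite doubleS exprS ler_peMr ?exprn_ege1 // (le_trans ler01).
pose lo' a i := if (i < k)%N then lo a i else - rho.
pose hi' a i := if (i < k)%N then hi a i else rho.
have boxk a w : (forall i, (i < m)%N -> lo' a i <= w i <= hi' a i) ->
    forall j, (j < k)%N -> lo a j <= w j <= hi a j.
  by move=> wb j jk; have := wb j (leq_trans jk km); rewrite /lo' /hi' jk.
have w0b' a i : (i < m)%N -> lo' a i <= w0 a i <= hi' a i.
  move=> im; rewrite /lo' /hi'; case: ifP => [/w0b//|_].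
  rewrite -ler_norml leNgt; apply/negP => lt.
  have : rho ^+ d.+1.*2 <= w0 a i ^+ d.+1.*2.
    rewrite -[leRHS]ger0_norm // normrX lerXn2r ?nnegrE ?normr_ge0 ?(le_trans ler01) //.
    exact: ltW.
  by rewrite leNgt (le_lt_trans (leS _ _ im) (Srho a)).
(* On each face of each box [F] has a positive minimum by compactness, so [M * F] exceeds [S (w0 a)]
   there for large [M]. The triple names the box, the coordinate and the side. *)
have [M HM] : exists M0, forall M, M0 <= M -> forall q : I * 'I_k * bool,
    0 <= M /\ forall w, (forall i, (i < m)%N -> lo' q.1.1 i <= w i <= hi' q.1.1 i) ->
    w q.1.2 = (if q.2 then lo' else hi') q.1.1 q.1.2 -> S (w0 q.1.1) < M * F w.
  apply: fin_eventually_forall => -[[a j] s] /=.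
  pose x := (if s then lo' else hi') a j.
  have jm := leq_trans (ltn_ord j) km.
  have lohi i : (i < m)%N -> lo' a i <= hi' a i.
    by move=> im; have /andP[/le_trans H /H] := w0b' a i im.
  have xb : lo' a j <= x <= hi' a j.
    by rewrite /x; case: s {x}; rewrite lexx ?andbT lohi.
  (* Fixing both bounds of coordinate [j] to [x] presents the face as a degenerate box. *)
  have [|z zb zmin] := @polyfun_min_box R m d.*2 F (upd (lo' a) j x) (upd (hi' a) j x) pF.
    by move=> i im; rewrite /upd; case: eqP => // _; apply: lohi.
  have zj : z j = x.
    by have := zb j jm; rewrite /upd eqxx => /le_anti.
  have zb' i : (i < m)%N -> lo' a i <= z i <= hi' a i.
    by move=> im; have := zb i im; rewrite /upd; case: eqP => // -> _; rewrite zj.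
  have Fz : 0 < F z.
    rewrite lt_neqAle F0 andbT eq_sym; apply/negP => /eqP Fz0.
    have [zlo zhi] := face a z Fz0 (boxk a z zb') j (ltn_ord j).
    move: zlo zhi; rewrite zj /x; clear.
    by case: s; rewrite /lo' /hi' ltn_ord eqxx.
  exists ((S (w0 a) + 1) / F z) => M HM.
  have M0 : 0 <= M by apply: le_trans HM; rewrite divr_ge0 // addr_ge0.
  split=> // w wb wj.
  have Fzw : F z <= F w.
    apply: zmin => i im; rewrite /upd; case: eqP => [->|_]; last exact: wb.
    by rewrite wj lexx.
  apply: (@lt_le_trans _ _ (M * F z)); last exact: ler_wpM2l.
  by move: HM; rewrite ler_pdivrMr // => /(lt_le_trans _)->//; rewrite ltrDl.
have {M HM}[M HM] : exists M, 0 <= M /\ forall a (j : 'I_k) w,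
    (forall i, (i < m)%N -> lo' a i <= w i <= hi' a i) ->
    w j = lo' a j \/ w j = hi' a j -> S (w0 a) < M * F w.
  (* The maximum secures [0 <= M] even if there are no faces. *)
  exists (Num.max 0 M); split; first by rewrite le_max lexx.
  have MM : M <= Num.max 0 M by rewrite le_max lexx orbT.
  move=> a j w wb [] wj.
    by have [_ ] := HM _ MM (a, j, true); apply.
  by have [_ ] := HM _ MM (a, j, false); apply.
have [M0 {}HM] := HM.
pose G w := M * F w + S w.
have pS : polyfun m d.+1.*2 S.
  have : forall s : seq 'I_m, polyfun m d.+1.*2
      (fun w : nat -> R => \sum_(i <- s) w i ^+ d.+1.*2).
    elim=> [|i s IHs].
      rewrite (_ : (fun w => _) = (fun=> 0)); first exact: polyfun_cst.
      by apply: funext => w; rewrite big_nil.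
    rewrite (_ : (fun w => _) = (fun w : nat -> R => w i ^+ d.+1.*2 +
        \sum_(i <- s) w i ^+ d.+1.*2)); last first.
      by apply: funext => w; rewrite big_cons.
    by apply: polyfun_add => //; apply: polyfun_exp.
  by apply.
have pG : polyfun m d.+1.*2 G.
  apply: polyfun_add => //; rewrite -[d.+1.*2]add0n.
  apply: (@polyfun_mul R m 0 _ (fun=> M) F); first exact: polyfun_cst.
  by apply: polyfun_leq pF => //; rewrite leq_double.
(* The minimum of [G] is at most [G (w0 a) = S (w0 a)]. On the faces [G] is larger: by the choice of
   [M] in the first [k] coordinates, by the choice of [rho] in the others. *)
have /choice[z Hz] : forall a, exists z,
    (forall i, (i < m)%N -> lo' a i < z i < hi' a i) /\
    forall w, (forall i, (i < m)%N -> lo' a i <= w i <= hi' a i) -> G z <= G w.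
  move=> a; have [|z zb zmin] := @polyfun_min_box R m _ G (lo' a) (hi' a) pG.
    by move=> i im; have /andP[/le_trans H /H] := w0b' a i im.
  exists z; split=> // i im.
  have : G z <= S (w0 a).
    by apply: le_trans (zmin _ (w0b' a)) _; rewrite /G w0F mulr0 add0r.
  have /andP[loz zhi] := zb i im; rewrite !lt_neqAle loz zhi !andbT => Gz.
  have [ik|ik] := boolP (i < k)%N.
    suff : ~ (z i = lo' a i \/ z i = hi' a i).
      by move=> H; apply/andP; split; apply/eqP => E; apply: H; [left|right].
    move=> /(HM a (Ordinal ik) z zb) lt.
    suff : S (w0 a) < S (w0 a) by rewrite ltxx.
    by apply: lt_le_trans lt (le_trans _ Gz); rewrite lerDl.
  suff zr : z i ^+ d.+1.*2 != rho ^+ d.+1.*2.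
    rewrite /lo' /hi' (negbTE ik); apply/andP; split; apply: contra zr.
      by move=> /eqP <-; rewrite exprNn -signr_odd odd_double expr0 mul1r.
    by move=> /eqP->.
  apply/negP => /eqP zr.
  suff : rho ^+ d.+1.*2 <= S (w0 a) by rewrite leNgt Srho.
  rewrite -zr; apply: le_trans (leS z i im) (le_trans _ Gz).
  by rewrite lerDr mulr_ge0.
have [F' HF'] := choice (fun i => polyfun_is_derive i pF).
(* This solves the critical equation [M * F' i w + (2d+2) * w i ^+ (2d+1) = 0] for the power of
   [w i]. *)
pose r i w := - (M / d.+1.*2%:R) * F' i w.
apply: (@card_reduced_points R m _ I z r).
- move=> a b /sep[j jk H]; have jm := leq_trans jk km; exists j => //.
  have := (Hz a).1 j jm; have := (Hz b).1 j jm; rewrite /lo' /hi' jk.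
  by case: H => H /andP[? ?] /andP[? ?]; apply/negP => /eqP ?; lra.
- move=> i im; have [pF' _ _] := HF' i.
  rewrite -[X in polyfun _ X]add0n; apply: (@polyfun_mul R m 0 _ (fun=> _)).
    exact: polyfun_cst.
  by apply: polyfun_leq pF' => //; exact: leq_pred.
- by [].
move=> i a im.
have [_ _ dF] := HF' i.
have dG := polyfun_critical pG im (Hz a).1 (Hz a).2.
have dS : is_derive (z a i) (1 : R) (fun t : R => S (upd (z a) i t))
    (d.+1.*2%:R * z a i ^+ d.*2.+1).
  pose c := \sum_(j < m | j != Ordinal im) z a j ^+ d.+1.*2.
  rewrite (_ : (fun t => _) = (fun t => (@id R ^+ d.+1.*2) t + cst c t)); last first.
    apply: funext => t; rewrite /S (bigD1 (Ordinal im)) //= {1}/upd eqxx.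
    congr (_ + _); first by rewrite fctE.
    by apply: eq_bigr => j; rewrite -val_eqE /= /upd => /negbTE->.
  have := is_deriveD (is_deriveX d.+1.*2 (is_derive_id (z a i) (1 : R)))
    (is_derive_cst c (z a i) (1 : R)).
  by rewrite addr0 /GRing.scale /= mulr1.
have dMF := is_deriveZ M (dF (z a)).
have := is_deriveD dMF dS.
move=> /@derive_val; rewrite /=.
have := dG => /@derive_val; rewrite /G /=.
move=> H1 H2.
have {H1 H2}: M *: F' i (z a) + d.+1.*2%:R * z a i ^+ d.*2.+1 = 0.
  by rewrite -H2 -H1.
rewrite /GRing.scale /= => /eqP; rewrite addrC addr_eq0 => /eqP H.
rewrite /r mulNr mulrAC -[RHS]mulNr -H mulrC mulKf //.
by rewrite pnatr_eq0.
Qed.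

(** * Computation trees *)

Definition evals (fs : seq ((nat -> R) -> R)) (w : nat -> R) : seq R :=
  [seq f w | f <- fs].

Lemma nth_evals fs w i : nth R0 (evals fs w) i = nth (fun=> R0) fs i w.
Proof. by elim: fs i => [|f fs IHfs] [|i] //=. Qed.

Definition operand_fun (inp env : seq ((nat -> R) -> R)) (o : operand) :
    (nat -> R) -> R :=
  match o with
  | In i => nth (fun=> R0) inp i
  | Val j => nth (fun=> R0) env j
  | Cst c => fun=> c
  end.

Lemma operand_valE inp env o w :
  operand_val (evals inp w) (evals env w) o = operand_fun inp env o w.
Proof. by case: o => [i|j|c] /=; rewrite ?nth_evals. Qed.

Definition in_box (k : nat) (lo hi w : nat -> R) : Prop :=
  forall j, (j < k)%N -> lo j <= w j <= hi j.

(* The inputs and auxiliary values reaching a node of the tree are the zeros of one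
   nonnegative polynomial [F] in the [k] free inputs and the variables introduced so far. *)
Record node_state (k : nat) (I : finType) (lo hi : I -> nat -> R)
    (inp : seq ((nat -> R) -> R)) (T : act) (m : nat) (F : (nat -> R) -> R)
    (env : seq ((nat -> R) -> R)) (A : {set I}) (W : I -> nat -> R) : Prop := NodeState {
  node_poly : polyfun m 6 F;
  node_ge0 : forall w, 0 <= F w;
  node_dim : (k <= m)%N;
  node_inp : forall i, polyfun m 1 (nth (fun=> R0) inp i);
  node_env : forall i, polyfun m 1 (nth (fun=> R0) env i);
  node_zero : forall a, a \in A -> F (W a) = 0;
  node_box : forall a, a \in A -> in_box k (lo a) (hi a) (W a);
  node_reject : forall a, a \in A ->
    act_eval T (evals inp (W a)) (evals env (W a)) = false;
  node_accept : forall a w, a \in A -> F w = 0 -> in_box k (lo a) (hi a) w ->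
    (exists2 j, (j < k)%N & w j = lo a j \/ w j = hi a j) ->
    act_eval T (evals inp w) (evals env w) = true }.

(** Each node of the tree splits the inputs into at most three cases and adds two variables, whence
    the factors 3 and [7 ^ 2]. The base 7 is [2 * 3 + 1], for [F] of degree [2 * 3]. *)
Definition tree_bounded (k : nat) (I : finType) (lo hi : I -> nat -> R)
    (inp : seq ((nat -> R) -> R)) (T : act) : Prop :=
  forall m F env A W, node_state k lo hi inp T m F env A W ->
    (#|A| <= 3 ^ act_depth T * 7 ^ (m + (act_depth T).*2))%N.

Section TreeBound.
Context (k : nat) (I : finType) (lo hi : I -> nat -> R) (inp : seq ((nat -> R) -> R)).

(** At an accepting leaf [A] is empty, since its members are rejected. At a rejecting leaf a zero of
    [F] on the boundary of a box would have to be accepted, so the separated zeros can be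
    counted. *)
Lemma tree_bounded_leaf b :
  (forall a b : I, a != b -> exists2 j, (j < k)%N & hi a j < lo b j \/ hi b j < lo a j) ->
  tree_bounded k lo hi inp (Leaf b).
Proof.
move=> sep m F env A W [pF F0 km _ _ FW bW rej acc]; rewrite /= mul1n addn0.
case: b rej acc => /= rej acc.
  suff -> : A = finset.set0 by rewrite cards0.
  by apply/setP => a; rewrite inE; apply/negP => /rej.
rewrite -card_sig.
apply: (@card_separated_zeros _ m k 3 F {a | a \in A}
  (fun a => lo (sval a)) (fun a => hi (sval a))) => //.
- by move=> a b ab; apply: sep.
- by move=> [a aA]; exists (W a); split; [exact: FW|exact: bW].
move=> [a aA] w Fw wb j jk /=.
by split; apply/negP => /eqP wj; suff : false = true by []; apply: (acc a w aA Fw wb);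
  exists j => //; [left|right].
Qed.

(** Two fresh variables suffice at every node: quotient and inverse for a division, the root and a
    witness of its sign for a square root. *)
Definition ext2 (m : nat) (w : nat -> R) (s t : R) : nat -> R :=
  upd (upd w m s) m.+1 t.

Lemma ext2_lt m w s t i : (i < m)%N -> ext2 m w s t i = w i.
Proof. by move=> im; rewrite /ext2 /upd !ifN //; apply/negP => /eqP; lia. Qed.

Lemma ext2_s m w s t : ext2 m w s t m = s.
Proof. by rewrite /ext2 /upd eqxx ifN // ltn_eqF. Qed.

Lemma ext2_t m w s t : ext2 m w s t m.+1 = t.
Proof. by rewrite /ext2 /upd eqxx. Qed.

Lemma polyfun_ext2 m d f w s t : polyfun m d f -> f (ext2 m w s t) = f w.
Proof. by move=> pf; apply: (polyfun_ext pf) => i im; rewrite ext2_lt. Qed.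

Lemma evals_ext2 m fs w s t : (forall i, polyfun m 1 (nth (fun=> R0) fs i)) ->
  evals fs (ext2 m w s t) = evals fs w.
Proof.
move=> pfs; apply: (@eq_from_nth _ R0); first by rewrite !size_map.
by move=> i _; rewrite !nth_evals; apply: polyfun_ext2 (pfs i).
Qed.

(** [A'] collects the boxes whose point [W a] falls into one case of the node, and [e1 = e2 = 0]
    describes that case. Adding the squares of [e1] and [e2] to [F] imposes both equations; their
    degree 3 keeps the total degree at 6. *)
Lemma node_step T T' m F env A W (A' : {set I}) e1 e2 v :
  node_state k lo hi inp T m F env A W -> tree_bounded k lo hi inp T' ->
  A' \subset A -> polyfun m.+2 3 e1 -> polyfun m.+2 3 e2 ->
  (forall i, polyfun m.+2 1 (nth (fun=> R0) (env ++ v) i)) ->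
  (forall a, a \in A' -> exists s t,
     e1 (ext2 m (W a) s t) = 0 /\ e2 (ext2 m (W a) s t) = 0) ->
  (forall w, F w = 0 -> e1 w = 0 -> e2 w = 0 ->
     act_eval T' (evals inp w) (evals (env ++ v) w) =
     act_eval T (evals inp w) (evals env w)) ->
  (#|A'| <= 3 ^ act_depth T' * 7 ^ (m + (act_depth T').+1.*2))%N.
Proof.
move=> [pF F0 km pinp penv FW bW rej acc] bT' sA' p1 p2 pv ext same.
have /choice[s /choice[t Hst]] : forall a, exists s t, a \in A' ->
    e1 (ext2 m (W a) s t) = 0 /\ e2 (ext2 m (W a) s t) = 0.
  move=> a; have [/ext[s [t H]]|_] := boolP (a \in A'); first by exists s, t.
  by exists 0, 0.
have -> : (m + (act_depth T').+1.*2 = m.+2 + (act_depth T').*2)%N by lia.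
have sA a : a \in A' -> a \in A by apply: (fintype.subsetP sA').
pose F' w := F w + e1 w * e1 w + e2 w * e2 w.
pose W' a := ext2 m (W a) (s a) (t a).
have F'0 w : F' w = 0 -> [/\ F w = 0, e1 w = 0 & e2 w = 0].
  move=> F'w; have := F0 w; move: F'w; rewrite /F'.
  have := sqr_ge0 (e1 w); have := sqr_ge0 (e2 w); rewrite !expr2 => h2 h1 h H0.
  have E1 : e1 w * e1 w = 0 by lra.
  have E2 : e2 w * e2 w = 0 by lra.
  split; first by lra.
    by move/eqP: E1; rewrite mulf_eq0 orbb => /eqP.
  by move/eqP: E2; rewrite mulf_eq0 orbb => /eqP.
have FW' a : a \in A' -> F' (W' a) = 0.
  move=> aA'; have [h1 h2] := Hst a aA'.
  by rewrite /F' /W' h1 h2 (polyfun_ext2 _ _ _ pF) FW ?sA // !mulr0 !addr0.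
apply: (bT' m.+2 F' (env ++ v) A' W'); split.
- apply: polyfun_add; last exact: (polyfun_mul p2 p2).
  apply: polyfun_add; last exact: (polyfun_mul p1 p1).
  by apply: polyfun_leq pF => //; lia.
- by move=> w; rewrite !addr_ge0 // -expr2 sqr_ge0.
- by lia.
- by move=> i; apply: polyfun_leq (pinp i) => //; lia.
- exact: pv.
- exact: FW'.
- by move=> a aA' j jk; rewrite /W' ext2_lt; [exact: bW (sA _ aA') _ jk|lia].
- move=> a aA'; have [h0 h1 h2] := F'0 _ (FW' _ aA').
  by rewrite same // /W' !evals_ext2 // rej ?sA.
- move=> a w aA' /F'0[h0 h1 h2] wb wj.
  by rewrite same //; apply: (acc a) => //; apply: sA.
Qed.

Lemma nth_env_rcons m env f :
  (forall i, polyfun m 1 (nth (fun=> R0) env i)) -> polyfun m.+2 1 f ->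
  forall i, polyfun m.+2 1 (nth (fun=> R0) (env ++ [:: f]) i).
Proof.
move=> penv pf i; rewrite nth_cat; case: ifP => _.
  by apply: polyfun_leq (penv i) => //; lia.
by case: (i - _)%N => [|[|j]] //=; apply: polyfun_cst.
Qed.

Lemma evals_rcons env f w : evals (env ++ [:: f]) w = rcons (evals env w) (f w).
Proof. by rewrite /evals map_cat cats1. Qed.

Lemma polyfun_operand T m F env A W o :
  node_state k lo hi inp T m F env A W -> polyfun m 1 (operand_fun inp env o).
Proof. by case: o => [i|j|c] [] *; rewrite /=; [| |exact: polyfun_cst]. Qed.

Lemma card_cases3 (A A1 A2 A3 : {set I}) (x y : nat) :
  A \subset A1 :|: A2 :|: A3 -> (#|A1| <= x)%N -> (#|A2| <= x)%N -> (#|A3| <= x)%N ->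
  (3 * x <= y)%N -> (#|A| <= y)%N.
Proof.
move=> /subset_leq_card sA h1 h2 h3 xy.
have := cardsU (A1 :|: A2) A3; have := cardsU A1 A2; lia.
Qed.

Lemma leq_pow3 h h' m : (h <= h')%N ->
  (3 ^ h * 7 ^ (m + h.+1.*2) <= 3 ^ h' * 7 ^ (m + h'.+1.*2))%N.
Proof. by move=> hh'; apply: leq_mul; rewrite leq_exp2l //; lia. Qed.

Lemma tree_bounded_op o x y T :
  tree_bounded k lo hi inp T -> tree_bounded k lo hi inp (Op o x y T).
Proof.
move=> bT m F env A W st; rewrite [act_depth _]/=.
have px := polyfun_operand x st; have py := polyfun_operand y st.
have penv := node_env st.
set f := operand_fun inp env x in px; set g := operand_fun inp env y in py.
have [pf pg] : polyfun m.+2 1 f /\ polyfun m.+2 1 g.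
  by split; [apply: polyfun_leq px|apply: polyfun_leq py]; lia.
have pm d : polyfun m.+2 d.+1 (fun w : nat -> R => w m) by apply: polyfun_var; lia.
have pm1 d : polyfun m.+2 d.+1 (fun w : nat -> R => w m.+1) by apply: polyfun_var; lia.
have p0 d : polyfun m.+2 d (fun=> 0 : R) by apply: polyfun_cst.
(* For the total operations one case is enough. Storing the result in the new variable [w m] keeps
   all entries of the environment at degree 1. *)
have simple h : polyfun m.+2 3 (fun w => w m - h w) ->
    (forall w s t, h (ext2 m w s t) = h w) ->
    (forall w, binop_val o (f w) (g w) = h w) ->
    (#|A| <= 3 ^ (act_depth T).+1 * 7 ^ (m + (act_depth T).+1.*2))%N.
  move=> ph hext hE; apply: (@leq_trans (3 ^ act_depth T * 7 ^ (m + (act_depth T).+1.*2))).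
    apply: (node_step st bT (subxx _) ph (p0 3%N) (nth_env_rcons penv (pm 0%N))).
      by move=> a _; exists (h (W a)), 0; rewrite ext2_s hext subrr.
    move=> w _ e1 _; rewrite evals_rcons /= !operand_valE hE.
    by congr (act_eval _ _ (rcons _ _)); lra.
  by apply: leq_mul => //; rewrite leq_exp2l.
case: o st simple => st simple.
- apply: (simple (fun w => f w + g w)) => //.
    apply: polyfun_sub => //; apply: polyfun_add;
      [apply: polyfun_leq pf|apply: polyfun_leq pg]; lia.
  by move=> w s t; rewrite (polyfun_ext2 _ _ _ px) (polyfun_ext2 _ _ _ py).
- apply: (simple (fun w => f w - g w)) => //.
    apply: polyfun_sub => //; apply: polyfun_sub;
      [apply: polyfun_leq pf|apply: polyfun_leq pg]; lia.
  by move=> w s t; rewrite (polyfun_ext2 _ _ _ px) (polyfun_ext2 _ _ _ py).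
- apply: (simple (fun w => f w * g w)) => //.
    apply: polyfun_sub => //; apply: polyfun_leq (polyfun_mul pf pg); lia.
  by move=> w s t; rewrite (polyfun_ext2 _ _ _ px) (polyfun_ext2 _ _ _ py).
move=> {simple}.
pose A1 := [set a in A | g (W a) != 0]; pose A2 := [set a in A | g (W a) == 0].
apply: (@card_cases3 A A1 A2 finset.set0 (3 ^ act_depth T * 7 ^ (m + (act_depth T).+1.*2))).
- by apply/fintype.subsetP => a aA; rewrite !inE aA /=; case: eqP.
(* Here [w m] is the quotient and [w m.+1] the inverse of the divisor, whose existence excludes a
   zero divisor. *)
- apply: (node_step (e1 := fun w => w m * g w - f w) (e2 := fun w => w m.+1 * g w - 1)
    st bT _ _ _ (nth_env_rcons penv (pm 0%N))).
  + by apply/fintype.subsetP => a; rewrite inE => /andP[].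
  + apply: polyfun_sub; last by apply: polyfun_leq pf.
    by apply: polyfun_leq (polyfun_mul (pm 0%N) pg).
  + apply: polyfun_sub; last exact: polyfun_cst.
    by apply: polyfun_leq (polyfun_mul (pm1 0%N) pg).
  + move=> a; rewrite inE => /andP[_ g0]; exists (f (W a) / g (W a)), (g (W a))^-1.
    rewrite ext2_s ext2_t (polyfun_ext2 _ _ _ px) (polyfun_ext2 _ _ _ py).
    by rewrite divfK // mulVf // !subrr.
  + move=> w _ e1 e2; rewrite evals_rcons /= !operand_valE -/f -/g.
    have g0 : g w != 0 by apply/eqP => g0; move: e2; rewrite g0 mulr0; lra.
    congr (act_eval _ _ (rcons _ _)); rewrite RdivE.
    by apply: (mulIf g0); rewrite divfK //; lra.
(* Division by zero yields 0 under the total division, so the constant 0 is stored. *)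
- apply: (node_step (e1 := g) (e2 := fun=> 0) st bT _ _ (p0 3%N)
    (nth_env_rcons penv (p0 1%N))).
  + by apply/fintype.subsetP => a; rewrite inE => /andP[].
  + by apply: polyfun_leq pg.
  + by move=> a; rewrite inE => /andP[_ /eqP g0]; exists 0, 0; rewrite (polyfun_ext2 _ _ _ py).
  + move=> w _ e1 _; rewrite evals_rcons /= !operand_valE -/f -/g e1.
    by rewrite /Rdiv Rinv_0 Rmult_0_r.
- by rewrite cards0.
by rewrite expnS mulnA.
Qed.

Lemma tree_bounded_sqrt x T :
  tree_bounded k lo hi inp T -> tree_bounded k lo hi inp (Sqrt x T).
Proof.
move=> bT m F env A W st; rewrite [act_depth _]/=.
have px := polyfun_operand x st; have penv := node_env st.
set f := operand_fun inp env x in px.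
have pf : polyfun m.+2 1 f by apply: polyfun_leq px; lia.
have pm d : polyfun m.+2 d.+1 (fun w : nat -> R => w m) by apply: polyfun_var; lia.
have pm1 d : polyfun m.+2 d.+1 (fun w : nat -> R => w m.+1) by apply: polyfun_var; lia.
have p0 d : polyfun m.+2 d (fun=> 0 : R) by apply: polyfun_cst.
pose A1 := [set a in A | 0 <= f (W a)]; pose A2 := [set a in A | f (W a) < 0].
apply: (@card_cases3 A A1 A2 finset.set0 (3 ^ act_depth T * 7 ^ (m + (act_depth T).+1.*2))).
- by apply/fintype.subsetP => a aA; rewrite !inE aA /=; case: ltP.
(* Being the square of [w m.+1], the value [w m] is the nonnegative root of [f w]. *)
- apply: (node_step (e1 := fun w => w m - w m.+1 * w m.+1)
    (e2 := fun w => w m * w m - f w) st bT _ _ _ (nth_env_rcons penv (pm 0%N))).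
  + by apply/fintype.subsetP => a; rewrite inE => /andP[].
  + apply: polyfun_sub => //.
    by apply: polyfun_leq (polyfun_mul (pm1 0%N) (pm1 0%N)).
  + apply: polyfun_sub; last by apply: polyfun_leq pf.
    by apply: polyfun_leq (polyfun_mul (pm 0%N) (pm 0%N)).
  + move=> a; rewrite inE => /andP[_ g0].
    exists (Num.sqrt (f (W a))), (Num.sqrt (Num.sqrt (f (W a)))).
    rewrite ext2_s ext2_t (polyfun_ext2 _ _ _ px) -!expr2 !sqr_sqrtr ?sqrtr_ge0 //.
    by rewrite !subrr.
  + move=> w _ e1 e2; rewrite evals_rcons /= !operand_valE -/f.
    congr (act_eval _ _ (rcons _ _)).
    have -> : f w = w m * w m by lra.
    rewrite sqrt_square //; apply/RleP; rewrite (_ : w m = w m.+1 * w m.+1); last by lra.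
    by rewrite -expr2 sqr_ge0.
(* The equation [f w * w m ^ 2 = -1] is solvable exactly for negative [f w], where the total square
   root is 0. *)
- apply: (node_step (e1 := fun w => f w * (w m * w m) + 1) (e2 := fun=> 0) st bT _ _ (p0 3%N)
    (nth_env_rcons penv (p0 1%N))).
  + by apply/fintype.subsetP => a; rewrite inE => /andP[].
  + apply: polyfun_add; last exact: polyfun_cst.
    exact: (polyfun_mul pf (polyfun_mul (pm 0%N) (pm 0%N))).
  + move=> a; rewrite inE => /andP[_ fneg].
    exists (Num.sqrt (- (f (W a))^-1)), 0; split=> //.
    rewrite ext2_s (polyfun_ext2 _ _ _ px) -expr2 sqr_sqrtr ?oppr_ge0 ?invr_le0 ?ltW //.
    by rewrite mulrN mulfV ?lt_eqF // addNr.
  + move=> w _ e1 _; rewrite evals_rcons /= !operand_valE -/f.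
    congr (act_eval _ _ (rcons _ _)); rewrite sqrt_neg_0 //; apply/RleP.
    have := sqr_ge0 (w m); rewrite expr2 => w0; move: e1; rewrite leNgt => e1.
    by apply/negP => f0; have := mulr_ge0 (ltW f0) w0; lra.
- by rewrite cards0.
by rewrite expnS mulnA.
Qed.

Lemma act_eval_branch x Tl Te Tg ix e :
  act_eval (Branch x Tl Te Tg) ix e =
  let v := operand_val ix e x in
  if v < 0 then act_eval Tl ix e else
  if v == 0 then act_eval Te ix e else act_eval Tg ix e.
Proof.
rewrite /=; case: total_order_T => [[/RltP ->//|->]|/RltP h].
  by rewrite ltxx eqxx.
by rewrite ltNge (ltW h) /= gt_eqF.
Qed.

(** A strict sign condition on [f] becomes an equation with an auxiliary variable [s]:
    [f * s ^ 2 = -1] for negative and [f * s ^ 2 = 1] for positive values. *)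
Lemma tree_bounded_branch x Tl Te Tg :
  tree_bounded k lo hi inp Tl -> tree_bounded k lo hi inp Te ->
  tree_bounded k lo hi inp Tg -> tree_bounded k lo hi inp (Branch x Tl Te Tg).
Proof.
move=> bTl bTe bTg m F env A W st.
have px := polyfun_operand x st; have penv := node_env st.
set f := operand_fun inp env x in px.
have pf : polyfun m.+2 1 f by apply: polyfun_leq px; lia.
have pm d : polyfun m.+2 d.+1 (fun w : nat -> R => w m) by apply: polyfun_var; lia.
have p0 d : polyfun m.+2 d (fun=> 0 : R) by apply: polyfun_cst.
have penv' i : polyfun m.+2 1 (nth (fun=> R0) (env ++ [::]) i).
  by rewrite cats0; apply: polyfun_leq (penv i); lia.
set T := Branch x Tl Te Tg in st *.
have ev w : act_eval T (evals inp w) (evals env w) =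
    if f w < 0 then act_eval Tl (evals inp w) (evals env w) else
    if f w == 0 then act_eval Te (evals inp w) (evals env w) else
    act_eval Tg (evals inp w) (evals env w).
  by rewrite act_eval_branch operand_valE.
set h := maxn (act_depth Tl) (maxn (act_depth Te) (act_depth Tg)).
have -> : act_depth T = h.+1 by [].
pose A1 := [set a in A | f (W a) < 0]; pose A2 := [set a in A | f (W a) == 0].
pose A3 := [set a in A | 0 < f (W a)].
apply: (@card_cases3 A A1 A2 A3 (3 ^ h * 7 ^ (m + h.+1.*2))).
- by apply/fintype.subsetP => a aA; rewrite !inE aA /=; case: ltgtP.
- apply: leq_trans (leq_pow3 m (_ : act_depth Tl <= h)%N); last by rewrite /h; lia.
  apply: (node_step (e1 := fun w => f w * (w m * w m) + 1) (e2 := fun=> 0)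
    (v := [::]) st bTl _ _ (p0 3%N) penv').
  + by apply/fintype.subsetP => a; rewrite inE => /andP[].
  + apply: polyfun_add; last exact: polyfun_cst.
    exact: (polyfun_mul pf (polyfun_mul (pm 0%N) (pm 0%N))).
  + move=> a; rewrite inE => /andP[_ fneg].
    exists (Num.sqrt (- (f (W a))^-1)), 0; split=> //.
    rewrite ext2_s (polyfun_ext2 _ _ _ px) -expr2 sqr_sqrtr ?oppr_ge0 ?invr_le0 ?ltW //.
    by rewrite mulrN mulfV ?lt_eqF // addNr.
  + move=> w _ e1 _; rewrite cats0 ev ifT //.
    have := sqr_ge0 (w m); rewrite expr2 => w0; rewrite ltNge.
    by apply/negP => f0; have := mulr_ge0 f0 w0; lra.
- apply: leq_trans (leq_pow3 m (_ : act_depth Te <= h)%N); last by rewrite /h; lia.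
  apply: (node_step (e1 := f) (e2 := fun=> 0) (v := [::]) st bTe _ _ (p0 3%N) penv').
  + by apply/fintype.subsetP => a; rewrite inE => /andP[].
  + by apply: polyfun_leq pf.
  + by move=> a; rewrite inE => /andP[_ /eqP g0]; exists 0, 0; rewrite (polyfun_ext2 _ _ _ px).
  + by move=> w _ e1 _; rewrite cats0 ev e1 ltxx eqxx.
- apply: leq_trans (leq_pow3 m (_ : act_depth Tg <= h)%N); last by rewrite /h; lia.
  apply: (node_step (e1 := fun w => f w * (w m * w m) - 1) (e2 := fun=> 0)
    (v := [::]) st bTg _ _ (p0 3%N) penv').
  + by apply/fintype.subsetP => a; rewrite inE => /andP[].
  + apply: polyfun_sub; last exact: polyfun_cst.
    exact: (polyfun_mul pf (polyfun_mul (pm 0%N) (pm 0%N))).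
  + move=> a; rewrite inE => /andP[_ fpos].
    exists (Num.sqrt (f (W a))^-1), 0; split=> //.
    rewrite ext2_s (polyfun_ext2 _ _ _ px) -expr2 sqr_sqrtr ?invr_ge0 ?ltW //.
    by rewrite mulfV ?gt_eqF // subrr.
  + move=> w _ e1 _; have f0 : 0 < f w.
      have := sqr_ge0 (w m); rewrite expr2 => w0; rewrite ltNge.
      by apply/negP => f0; have := mulr_le0_ge0 f0 w0; lra.
    by rewrite cats0 ev ltNge (ltW f0) gt_eqF.
by rewrite expnS mulnA.
Qed.

Lemma act_tree_bounded T :
  (forall a b : I, a != b -> exists2 j, (j < k)%N & hi a j < lo b j \/ hi b j < lo a j) ->
  tree_bounded k lo hi inp T.
Proof.
move=> sep; elim: T => [b|o x y T IHT|x T IHT|x Tl IHl Te IHe Tg IHg].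
- exact: tree_bounded_leaf.
- exact: tree_bounded_op.
- exact: tree_bounded_sqrt.
- exact: tree_bounded_branch.
Qed.

End TreeBound.

(** * Tours through points on two lines *)

Definition short_edge (pts : nat -> R * R) (B : R) : rel nat :=
  fun i j => edist (pts i) (pts j) <= B.

Lemma bottleneck_leE pts x p B :
  bottleneck_le pts (x :: p) B <-> path (short_edge pts B) x (rcons p x).
Proof.
have nthS i : (i <= size p)%N ->
    nth 0%N (rcons p x) i = nth 0%N (x :: p) (i.+1 %% size (x :: p)).
  move=> ip; rewrite nth_rcons /=; case: ltngtP ip => // [ip|->] _.
    by rewrite modn_small.
  by rewrite modnn.
split=> [H|/(pathP 0%N) H i /= ip].
  apply/(pathP 0%N) => i; rewrite size_rcons ltnS => ip.
  rewrite nthS // -rcons_cons nth_rcons /= ltnS ip.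
  by apply/RleP; apply: H.
have := H i; rewrite size_rcons => /(_ ip); rewrite nthS //.
by rewrite -rcons_cons nth_rcons ip => /RleP.
Qed.

Lemma path_crossing (T : eqType) (e : rel T) (P : pred T) x p :
  path e x p -> P x -> ~~ P (last x p) ->
  exists y z, [/\ y \in belast x p, z \in p, e y z, P y & ~~ P z].
Proof.
elim: p x => [|y p IHp] x /=; first by move=> _ ->.
move=> /andP[exy py] Px Pl; have [Py|Py] := boolP (P y); last first.
  by exists x, y; split=> //; rewrite inE eqxx.
have [u [v [hu hv euv Pu Pv]]] := IHp y py Py Pl.
by exists u, v; split=> //; rewrite inE ?hu ?hv orbT.
Qed.

Lemma path_complete (T : eqType) (e : rel T) (P : pred T) x p :
  (forall y z, P y -> P z -> e y z) -> P x -> all P p -> path e x p.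
Proof.
move=> eP; elim: p x => //= y p IHp x Px /andP[Py Pp].
by rewrite eP // IHp.
Qed.

Definition two_lines (c : nat) (B : R) (h : nat -> R) (i : nat) : R * R :=
  (if (i <= c)%N then 0 else B, h i).

Lemma edistE p q :
  edist p q = Num.sqrt ((p.1 - q.1) ^+ 2 + (p.2 - q.2) ^+ 2).
Proof. by rewrite /edist RsqrtE !expr2. Qed.

Lemma edist_same_line c B h i j : 0 <= B -> (i <= c)%N = (j <= c)%N ->
  short_edge (two_lines c B h) B i j = (`|h i - h j| <= B).
Proof.
move=> B0 ij; rewrite /short_edge edistE /two_lines /= ij.
by rewrite subrr expr0n add0r sqrtr_sqr.
Qed.

(** The horizontal distance alone is already [B], so any difference in height makes the edge too
    long. *)
Lemma edist_across c B h i j : 0 < B -> (i <= c < j)%N ->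
  (short_edge (two_lines c B h) B i j = (h i == h j)) *
  (short_edge (two_lines c B h) B j i = (h i == h j)).
Proof.
move=> B0 /andP[ic cj]; have jc : (j <= c)%N = false by rewrite leqNgt cj.
have key (x y : R) : (Num.sqrt (B ^+ 2 + (x - y) ^+ 2) <= B) = (x == y).
  rewrite -{2}(ger0_norm (ltW B0)) -sqrtr_sqr ler_sqrt ?sqr_ge0 //.
  by rewrite gerDl exprn_even_le0 //= subr_eq0.
rewrite /short_edge !edistE /two_lines /= ic jc sub0r subr0 sqrrN.
by rewrite !key [h j == _]eq_sym.
Qed.

(** The tour visits all indices but [i] and [j] in increasing order, crossing by the bridge from [c]
    to [c.+1], and returns from [n.-1] through [j] and [i], crossing by this level pair. All other
    edges stay on one line. *)
Lemma two_lines_yes n c B h i j : 0 < B ->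
  (forall x y, (x < n)%N -> (y < n)%N -> `|h x - h y| <= B) ->
  h c = h c.+1 -> (0 < i < c)%N -> (c.+1 < j < n.-1)%N -> h i = h j ->
  BPTSP_yes n (two_lines c B h) B.
Proof.
move=> B0 hB hc ic jc hij.
pose p x := (x != i) && (x != j).
pose aL := [seq x <- iota 1 c.-1 | p x].
pose aR := [seq x <- iota c.+2 (n - c - 3) | p x].
pose a := aL ++ [:: c, c.+1 & aR].
have aE : a = [seq x <- iota 1 (n - 2) | p x].
  have -> : (n - 2 = c.-1 + (1 + (1 + (n - c - 3))))%N by lia.
  rewrite !iotaD !filter_cat /= (_ : 1 + c.-1 = c)%N; last by lia.
  by rewrite !addn1 /p !ifT //; lia.
exists (0%N :: a ++ n.-1 :: [:: j; i]); split; first split.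
- apply: uniq_perm.
  + rewrite /= mem_cat cat_uniq aE filter_uniq ?iota_uniq //= !inE !mem_filter !mem_iota /p.
    by lia.
  + exact: iota_uniq.
  + move=> x; rewrite inE mem_cat aE mem_filter !inE !mem_iota /p.
    by lia.
- exists a, [:: j; i]; split=> //; split; last by rewrite /=; lia.
  by rewrite aE; apply: sorted_filter; [exact: ltn_trans|exact: iota_ltn_sorted].
apply/bottleneck_leE; set e := short_edge _ _.
pose Lf x := (x <= c)%N; pose Rt x := (c < x < n)%N.
have eL x y : Lf x -> Lf y -> e x y.
  move=> xc yc; rewrite /e edist_same_line ?(ltW B0) //; last by rewrite [LHS]xc [RHS]yc.
  by apply: hB; rewrite /Lf in xc yc; lia.
have eR x y : Rt x -> Rt y -> e x y.
  move=> /andP[xc xn] /andP[yc yn].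
  rewrite /e edist_same_line ?(ltW B0) //; first exact: hB.
  by rewrite leqNgt xc [RHS]leqNgt yc.
rewrite /a -catA rcons_cat /= cat_path /=.
apply/and4P; split.
- apply: (path_complete eL) => //; apply/allP => x; rewrite mem_filter mem_iota /Lf; lia.
- apply: eL; rewrite /Lf //.
  have : last 0%N aL \in 0%N :: aL by apply: mem_last.
  by rewrite inE mem_filter mem_iota; lia.
- by rewrite /e edist_across ?hc //; lia.
rewrite rcons_cat cat_path /=; apply/and5P; split.
- apply: (path_complete eR); rewrite /Rt; first by lia.
  by apply/allP => x; rewrite mem_filter mem_iota; lia.
- apply: eR; rewrite /Rt; last by lia.
  have : last c.+1 aR \in c.+1 :: aR by apply: mem_last.
  by rewrite inE mem_filter mem_iota; lia.
- by apply: eR; rewrite /Rt; lia.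
- have icj : (i <= c < j)%N by lia.
  by rewrite /e (edist_across h B0 icj).2 hij.
- by rewrite andbT; apply: eL; rewrite /Lf; lia.
Qed.

(* Both halves of the tour cross between the two lines, and both crossings would use
   the point [c]. *)
Lemma two_lines_no n c B h : 0 < B -> (0 < c < n.-1)%N ->
  (forall i j, (i <= c < j)%N -> (j < n)%N -> h i = h j -> i = c) ->
  ~ BPTSP_yes n (two_lines c B h) B.
Proof.
move=> B0 cn hc [t [[pt [a [b [tE _]]]] ]].
have tn x : x \in t -> (x < n)%N by rewrite (perm_mem pt) mem_iota.
have tu : uniq t by rewrite (perm_uniq pt) iota_uniq.
move: tn tu; rewrite {}tE {pt t} => tn tu /bottleneck_leE.
set e := short_edge _ _.
rewrite rcons_cat rcons_cons -cat_rcons cat_path last_rcons => /andP[pa pb].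
(* The ascending half leads from the left line to the right one, and its crossing edge starts at
   [c]. The start 0 of the tour is not [c]. *)
have c_a : c \in a.
  have [||y [z [yb zp eyz yc zc]]] := path_crossing (P := fun x => (x <= c)%N) pa.
  - by [].
  - by rewrite last_rcons -ltnNge; lia.
  rewrite -ltnNge in zc; rewrite belast_rcons in yb.
  have zn : (z < n)%N.
    apply: tn; rewrite inE mem_cat inE; move: zp; rewrite mem_rcons inE.
    by move=> /orP[->|->]; rewrite !orbT.
  have yE : y = c.
    apply: (hc y z) => //; first by lia.
    by apply/eqP; move: eyz; rewrite /e edist_across ?B0 //; lia.
  by move: yb; rewrite yE inE => /orP[/eqP|//]; lia.
have c_b : c \in b.
  have [||y [z [yb zp eyz yc zc]]] := path_crossing (P := fun x => (c < x)%N) pb.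
  - by lia.
  - by rewrite last_rcons.
  rewrite -leqNgt in zc; rewrite belast_rcons in yb.
  have yn : (y < n)%N by apply: tn; rewrite inE mem_cat yb !orbT.
  have zE : z = c.
    apply: (hc z y) => //; first by lia.
    have zcy : (z <= c < y)%N by lia.
    by apply/eqP; move: eyz; rewrite /e (edist_across h B0 zcy).2.
  by move: zp; rewrite zE mem_rcons inE => /orP[/eqP|//]; lia.
move: tu; rewrite /= cat_uniq => /and4P[_ _ /negP[]].
by apply/hasP; exists c => //; rewrite inE c_b orbT.
Qed.

(** * The hard instances *)

(* The first line carries the indices [0 .. L+1] and the second one the indices
   [L+2 .. L+k+3].  The indices [L+1] and [L+2] form the bridge at height 0; only the
   heights of the indices [L+3 .. L+k+2] are free. *)
Definition hard_height (L k : nat) (w : nat -> R) (i : nat) : R :=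
  if i == 0%N then -1 else
  if (i <= L)%N then i%:R else
  if (i <= L.+2)%N then 0 else
  if (i < L + 3 + k)%N then w (i - (L + 3))%N else -2%:R.

Variant hard_height_spec (L k : nat) (w : nat -> R) (i : nat) : R -> Prop :=
| HardFirst of i = 0%N : hard_height_spec L k w i (-1)%R
| HardLeft of (0 < i <= L)%N : hard_height_spec L k w i i%:R%R
| HardBridge of (L < i <= L.+2)%N : hard_height_spec L k w i 0%R
| HardFree of (L.+2 < i < L + 3 + k)%N & (i - (L + 3) < k)%N :
    hard_height_spec L k w i (w (i - (L + 3))%N)
| HardLast of (L + 3 + k <= i)%N : hard_height_spec L k w i (-2%:R)%R.

Lemma hard_heightP L k w i : hard_height_spec L k w i (hard_height L k w i).
Proof.
rewrite /hard_height; case: eqP => [i0|i0]; first by constructor.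
case: (leqP i L) => iL; first by constructor; lia.
case: (leqP i L.+2) => iL2; first by constructor; lia.
by case: (ltnP i (L + 3 + k)) => iLk; constructor; lia.
Qed.

Definition perm_at k (s : 'S_k) (j : nat) : nat := if insub j is Some j' then s j' else 0%N.

(** The intervals [[2p+1, 2p+2]] have positive integer ends and are disjoint for different [p]. This
    separates the cubes of different permutations as well as the coordinates of a point in one
    cube. *)
Definition cube_lo k (s : 'S_k) (j : nat) : R := (perm_at s j).*2.+1%:R.
Definition cube_hi k (s : 'S_k) (j : nat) : R := (perm_at s j).*2.+2%:R.

Lemma perm_at_lt k (s : 'S_k) j : (j < k)%N -> (perm_at s j < k)%N.
Proof. by move=> jk; rewrite /perm_at insubT /=. Qed.

Lemma perm_at_inj k (s : 'S_k) i j : (i < k)%N -> (j < k)%N ->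
  perm_at s i = perm_at s j -> i = j.
Proof.
move=> ik jk; rewrite /perm_at !insubT /= => /val_inj/perm_inj.
by move=> /(congr1 val).
Qed.

Lemma cubes_separated k (s t : 'S_k) : s != t ->
  exists2 j, (j < k)%N & cube_hi s j < cube_lo t j \/ cube_hi t j < cube_lo s j.
Proof.
move=> st; suff [j sj] : exists j, s j != t j.
  have perm_atE (u : 'S_k) : perm_at u j = u j by rewrite /perm_at valK.
  exists j => //; rewrite /cube_hi /cube_lo !perm_atE !ltr_nat.
  by move: sj; rewrite -val_eqE /=; lia.
by apply/existsP; apply: contraNT st; rewrite negb_exists => /forallP H;
  apply/eqP/permP => j; apply/eqP; have := H j; rewrite negbK.
Qed.

Section HardInstance.
(** The ends of the intervals are at most [2k], so [kL] places all of them among the heights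
    [1, ..., L] on the left line. *)
Context (L k : nat) (kL : (k.*2 <= L)%N).

Let n := (L + k + 4)%N.
(** All heights lie between -2 and [L], so every edge within one line has length at most [L.+2]. *)
Let B : R := L.+2%:R.
Let h := hard_height L k.

Lemma cube_bounds (s : 'S_k) w j : in_box k (cube_lo s) (cube_hi s) w -> (j < k)%N ->
  1 <= w j <= L%:R.
Proof.
move=> wb jk; have /andP[lo hi] := wb j jk; have sk := perm_at_lt s jk.
apply/andP; split; [apply: le_trans _ lo|apply: le_trans hi _];
  by rewrite /cube_lo /cube_hi ?ler1n ?ler_nat //; lia.
Qed.

Lemma hard_height_bounds (s : 'S_k) w i : in_box k (cube_lo s) (cube_hi s) w ->
  -2%:R <= h w i <= L%:R.
Proof.
move=> wb; have L0 : 0 <= L%:R :> R by [].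
rewrite /h; case: hard_heightP => [_|iL|_|_ jk|_]; try by apply/andP; split; lra.
  have : i%:R <= L%:R :> R by rewrite ler_nat; lia.
  have : 0 <= i%:R :> R by [].
  by move=> *; apply/andP; split; lra.
have := cube_bounds wb jk; lra.
Qed.

Lemma hard_height_diff (s : 'S_k) w i j : in_box k (cube_lo s) (cube_hi s) w ->
  `|h w i - h w j| <= B.
Proof.
move=> wb; have := hard_height_bounds i wb; have := hard_height_bounds j wb.
rewrite /B -addn2 natrD ler_norml; lra.
Qed.

(** The left line has the heights -1, 0 and [1, ..., L]. The right line has 0, -2 and the free
    heights, which are positive and lie in disjoint intervals. *)
Lemma hard_points_distinct (s : 'S_k) w i j : in_box k (cube_lo s) (cube_hi s) w ->
  (i < n)%N -> (j < n)%N -> i <> j ->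
  two_lines L.+1 B (h w) i <> two_lines L.+1 B (h w) j.
Proof.
move=> wb ni nj ij [e1 e2]; have B0 : B <> 0 by move=> /eqP; rewrite pnatr_eq0.
have side : (i <= L.+1)%N = (j <= L.+1)%N.
  by move: e1; case: leqP => _; case: leqP => _ // e; case: B0.
move: e1 e2 => _; rewrite /h; rewrite /n in ni nj.
have nat_neqN1 a : (a%:R : R) <> -1.
  by have : 0 <= a%:R :> R by []; lra.
case: (hard_heightP L k w i) => [i0|i0|i0|i0 ik|i0];
  case: (hard_heightP L k w j) => [j0|j0|j0|j0 jk|j0]; try lia; try lra.
- by move=> /esym/nat_neqN1.
- by move=> /nat_neqN1.
- by move=> /eqP; rewrite eqr_nat => /eqP.
- by move=> /eqP; rewrite pnatr_eq0; lia.
- by move=> /esym/eqP; rewrite pnatr_eq0; lia.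
- by have := cube_bounds wb jk; lra.
- by have := cube_bounds wb ik; lra.
- have /andP[loi hii] := wb _ ik; have /andP[loj hij] := wb _ jk => e.
  rewrite e in loi hii.
  have : (cube_lo s (i - (L + 3)) <= cube_hi s (j - (L + 3))) by lra.
  have : (cube_lo s (j - (L + 3)) <= cube_hi s (i - (L + 3))) by lra.
  rewrite /cube_lo /cube_hi !ler_nat => h1 h2.
  have : perm_at s (i - (L + 3)) = perm_at s (j - (L + 3)) by lia.
  by move=> /(perm_at_inj ik jk); lia.
- by have := cube_bounds wb ik; lra.
- by have := cube_bounds wb jk; lra.
Qed.

(** The bridge is the only level pair across the lines: a free height lies strictly between
    consecutive integers, and -1 and -2 have no counterpart on the opposite line. *)
Lemma hard_interior_no (s : 'S_k) (w : nat -> R) :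
  (forall j, (j < k)%N -> cube_lo s j < w j < cube_hi s j) ->
  ~ BPTSP_yes n (two_lines L.+1 B (h w)) B.
Proof.
move=> wb; apply: two_lines_no; first by rewrite ltr0n.
  by rewrite /n; lia.
move=> i j icj jn; rewrite /h; rewrite /n in jn.
have wb' : in_box k (cube_lo s) (cube_hi s) w.
  by move=> l lk; have /andP[/ltW -> /ltW ->] := wb l lk.
case: (hard_heightP L k w i) => [i0|i0|i0|i0 ik|i0];
  case: (hard_heightP L k w j) => [j0|j0|j0|j0 jk|j0]; try lia;
  move=> e; exfalso; move: e; try lra.
- by have := cube_bounds wb' jk; lra.
- by move=> /eqP; rewrite pnatr_eq0; lia.
- move=> e; have /andP[] := wb _ jk.
  by rewrite -e /cube_lo /cube_hi !ltr_nat; lia.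
- by have : 0 <= i%:R :> R by []; lra.
Qed.

(** A free height at an end of its interval is an integer from 1 to [L], hence level with a left
    point, which gives the second crossing. *)
Lemma hard_boundary_yes (s : 'S_k) w j : in_box k (cube_lo s) (cube_hi s) w -> (j < k)%N ->
  w j = cube_lo s j \/ w j = cube_hi s j ->
  BPTSP_yes n (two_lines L.+1 B (h w)) B.
Proof.
move=> wb jk wj; have sk := perm_at_lt s jk.
have [i iL wi] : exists2 i, (0 < i <= L)%N & w j = i%:R.
  by case: wj => ->; [exists (perm_at s j).*2.+1|exists (perm_at s j).*2.+2] => //; lia.
apply: (two_lines_yes (i := i) (j := (L + 3 + j)%N)).
- by rewrite ltr0n.
- by move=> x y _ _; apply: hard_height_diff wb.
- rewrite /h; case: (hard_heightP L k w L.+1); try lia.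
  by case: (hard_heightP L k w L.+2); try lia.
- by lia.
- by rewrite /n; lia.
rewrite /h; case: (hard_heightP L k w i); try lia.
case: (hard_heightP L k w (L + 3 + j)); try lia.
by rewrite addKn wi.
Qed.

Let inputs : seq ((nat -> R) -> R) :=
  flatten [seq [:: (fun w => (two_lines L.+1 B (h w) i).1);
                   (fun w => (two_lines L.+1 B (h w) i).2)] | i <- iota 0 n]
  ++ [:: fun=> B].

Lemma evals_inputs w : evals inputs w = encode n (two_lines L.+1 B (h w)) B.
Proof.
rewrite /evals /inputs /encode map_cat map_flatten -map_comp.
by congr (flatten _ ++ _).
Qed.

Lemma polyfun_inputs i : polyfun k 1 (nth (fun=> R0) inputs i).
Proof.
rewrite /inputs; elim: (iota 0 n) i => [|x s IHs] [|[|i]] /=; try exact: polyfun_cst.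
- rewrite /h /hard_height.
  case: eqP => _; first exact: polyfun_cst.
  case: (leqP x L) => _; first exact: polyfun_cst.
  case: (leqP x L.+2) => [_|x2]; first exact: polyfun_cst.
  case: (ltnP x (L + 3 + k)) => [xk|_]; last exact: polyfun_cst.
  by apply: polyfun_var; lia.
- exact: IHs.
Qed.

Lemma fact_le_tree T : decides_BPTSP n T ->
  (k`! <= 3 ^ act_depth T * 7 ^ (k + (act_depth T).*2))%N.
Proof.
move=> dT.
have B0 : Rlt R0 B by apply/RltP; rewrite ltr0n.
(* The centres of the cubes serve as the no-instances. *)
pose W (s : 'S_k) j : R := cube_lo s j + 2^-1.
have W_in (s : 'S_k) j : cube_lo s j < W s j < cube_hi s j.
  have -> : cube_hi s j = cube_lo s j + 1 by rewrite /cube_hi -addn1 natrD.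
  by rewrite /W; apply/andP; split; lra.
have W_box (s : 'S_k) : in_box k (cube_lo s) (cube_hi s) (W s).
  by move=> j _; have /andP[/ltW -> /ltW ->] := W_in s j.
have evT (s : 'S_k) w : in_box k (cube_lo s) (cube_hi s) w ->
    act_eval T (evals inputs w) (evals [::] w) = true <->
    BPTSP_yes n (two_lines L.+1 B (h w)) B.
  move=> wb; rewrite evals_inputs; apply: dT => // i j ni nj ij.
  exact: (hard_points_distinct wb).
rewrite -card_Sn -cardsT.
have bT := @act_tree_bounded k _ _ _ inputs T (@cubes_separated k).
(* At the root no constraint has been collected, so [F] is 0, the environment is empty and all cubes
   are present. *)
apply: (bT k (fun=> 0) [::] _ W); split=> //.
- exact: polyfun_cst.
- exact: polyfun_inputs.
- by move=> i; rewrite nth_nil; apply: polyfun_cst.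
- move=> s _; apply/negP => /(evT _ _ (W_box s)).
  by apply: (@hard_interior_no s) => j _; apply: W_in.
- move=> s w _ _ wb [j jk wj]; apply/(evT _ _ wb).
  exact: (hard_boundary_yes wb jk wj).
Qed.

End HardInstance.

(** * From the factorial bound to [n log n] *)

Lemma expn_le_fact q j : (q ^ j <= (q + j)`!)%N.
Proof.
elim: j => [|j IHj]; first by rewrite expn0 fact_gt0.
by rewrite addnS factS expnS leq_mul //; lia.
Qed.

(** The instance has [k = 2q] free points and [L = n - 2q - 4]. With [q ^ q <= (2q)!] and
    [147 = 3 * 49] the tree bound reads [q ^ q <= 147 ^ h * 49 ^ q] for depth [h]. *)
Lemma decides_BPTSP_expn_le n T : (8 * 49 ^ 2 <= n)%N -> decides_BPTSP n T ->
  ((n %/ 8) ^ (n %/ 8) <= 147 ^ (act_depth T).*2)%N.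
Proof.
set q := (n %/ 8)%N => nN dT.
have q49 : (49 ^ 2 <= q)%N by rewrite leq_divRL // mulnC.
have qn : (q * 8 <= n)%N by apply: leq_trunc_div.
have q2 : (2 <= q)%N by apply: leq_trans q49.
have nE : (n = (n - q.*2 - 4) + q.*2 + 4)%N by lia.
have := @fact_le_tree (n - q.*2 - 4) q.*2; rewrite -nE => /(_ _ T dT) H.
have {H} H : (q ^ q <= 147 ^ act_depth T * 49 ^ q)%N.
  apply: leq_trans (expn_le_fact q q) _; rewrite addnn; apply: leq_trans (H _) _; first by lia.
  have E j : (7 ^ j.*2 = 49 ^ j)%N by rewrite -mul2n expnM.
  by rewrite expnD !E mulnCA -expnMn mulnC.
have q0 : (0 < q ^ q)%N by rewrite expn_gt0; lia.
(* The bound is squared; then [49 ^ (2q) <= q ^ q], by [49 ^ 2 <= q], cancels one factor [q ^ q]. *)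
rewrite -(leq_pmul2r q0); apply: leq_trans (leq_mul H H) _.
rewrite -mulnACA -expnD addnn; apply: leq_mul => //.
by rewrite -expnMn leq_exp2r //; lia.
Qed.

Lemma ln_le_compat x y : Rlt 0 x -> Rle x y -> Rle (ln x) (ln y).
Proof.
move=> x0 /Rle_lt_or_eq_dec[xy|->]; last exact: Rle_refl.
exact/Rlt_le/ln_increasing.
Qed.

Lemma ln_expn_le a b x y : (0 < a)%N -> (0 < b)%N -> (a ^ x <= b ^ y)%N ->
  Rle (Rmult (INR x) (ln (INR a))) (Rmult (INR y) (ln (INR b))).
Proof.
move=> a0 b0 le.
have pos c : (0 < c)%N -> Rlt 0 (INR c) by move=> c0; apply/lt_0_INR/ssrnat.ltP.
rewrite -!ln_pow; try exact: pos.
apply: ln_le_compat; first exact/pow_lt/pos.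
by apply/RleP; rewrite !RpowE !INRE -!natrX ler_nat.
Qed.

Lemma INR_leq a b : (a <= b)%N -> Rle (INR a) (INR b).
Proof. by move=> ab; apply/le_INR/ssrnat.leP. Qed.

Theorem theorem13 :
  exists c : R, Rlt R0 c /\
  exists N : nat, forall n : nat, (N <= n)%N ->
    forall T : act, decides_BPTSP n T ->
      Rle (Rmult (Rmult c (INR n)) (ln (INR n))) (INR (act_depth T)).
Proof.
have l147 : Rlt 0 (ln (INR 147)).
  have := ln_increasing 1 (INR 147) Rlt_0_1 (lt_INR 1 147 _).
  by rewrite ln_1; apply; apply/ssrnat.ltP.
(* The constant 64 is [16 * 2 * 2], from [n <= 16 * q], [ln n <= 2 * ln q] and
   [q * ln q <= 2 * d * ln 147]. *)
exists (Rinv (Rmult (INR 64) (ln (INR 147)))).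
have c0 : Rlt 0 (Rmult (INR 64) (ln (INR 147))).
  by apply: Rmult_lt_0_compat => //; apply/lt_0_INR/ssrnat.ltP.
split; first exact: Rinv_0_lt_compat.
exists (8 * 49 ^ 2)%N => n nN T dT.
have := decides_BPTSP_expn_le nN dT; set q := (n %/ 8)%N; set d := act_depth T => pw.
have q16 : (16 <= q)%N.
  by apply: (@leq_trans (49 ^ 2)%N); rewrite // leq_divRL // mulnC.
have nq : (n <= 16 * q)%N by have := ltn_ceil n (isT : 0 < 8)%N; rewrite -/q; lia.
have nqq : (n ^ 1 <= q ^ 2)%N by apply: leq_trans nq _; rewrite leq_mul.
have n0 : (0 < n)%N by apply: leq_trans nN.
have q0 : (0 < q)%N by apply: leq_trans q16.
have H1 := ln_expn_le q0 (isT : 0 < 147)%N pw.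
have H2 := ln_expn_le n0 q0 nqq.
have H3 := INR_leq nq.
have H4 : Rle 0 (ln (INR n)).
  by rewrite -ln_1; apply: ln_le_compat; [exact: Rlt_0_1|exact: (@INR_leq 1)].
have H5 : Rle 0 (INR q) by exact: pos_INR.
move: H1 H2 H3; rewrite -mul2n !mult_INR.
have -> : INR 1 = IZR 1 by [].
have -> : INR 2 = IZR 2 by [].
have E16 : INR 16 = IZR 16 by rewrite INR_IZR_INZ.
have E64 : INR 64 = IZR 64 by rewrite INR_IZR_INZ.
rewrite E16 {E16} => H1 H2 H3.
rewrite Rmult_assoc; apply: (Rmult_le_reg_l _ _ _ c0).
rewrite -Rmult_assoc Rinv_r; last exact: Rgt_not_eq.
rewrite E64; move: (ln (INR n)) (ln (INR q)) (ln (INR 147)) (INR n) (INR q) (INR d)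
  H1 H2 H3 H4 H5 {l147 c0} => ln_n ln_q ln_147 x y z H1 H2 H3 H4 H5.
have G1 := Rmult_le_compat_r _ _ _ H4 H3.
have G2 := Rmult_le_compat_l _ _ _ H5 H2.
Psatz.nra.
Qed.
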